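(* Let $X$ be a $d$-box and let $\mathcal{F}=\mathcal{F}_1\times\cdots\times\mathcal{F}_d$, where each $\mathcal{F}_i\subseteq\mathrm{pud}(X_i)$ contains exactly one of $C$, $X_i\setminus C$ for every $C\in\mathrm{pud}(X_i)$. Put $\mathcal{B}_i=\mathcal{F}_i\cup\{X_i\}$ and $\mathcal{B}=\mathcal{B}_1\times\cdots\times\mathcal{B}_d$ (a set of boxes of $X$). For $D\in\mathcal{B}$ let $\tau_D(A)=\prod_{i=1}^d\tau_{D_i}(A_i)$ for proper boxes $A$, where $\tau_{D_i}=\varphi_{D_i}$ if $D_i\in\mathcal{F}_i$ and $\tau_{D_i}=1-\chi_{\mathcal{F}_i}$ if $D_i=X_i$. Then $\mathbb{Z}\mathrm{Pud}X=N(X)\oplus\mathbb{Z}\mathcal{B}$. Moreover, the map $P:\mathbb{Z}\mathrm{Pud}X\to\mathbb{Z}\mathcal{B}$, $P(x)=\sum_{D\in\mathcal{B}}\tau_D^\dagger(x)D$, is a projection onto $\mathbb{Z}\mathcal{B}$ with $\ker P=N(X)$ and $P(\mathbb{Z}\mathrm{pud}X)=\mathbb{Z}\mathcal{B}$.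
   Context: A $d$-box is $X=X_1\times\cdots\times X_d$ with finite nonempty sets $X_i$. A box is a nonempty $A_1\times\cdots\times A_d$ with $A_i\subseteq X_i$, proper if $A_i\neq X_i$ for all $i$; $\mathrm{Pud}X$ is the set of all boxes, $\mathrm{pud}X$ the set of proper boxes, and $\mathrm{pud}(X_i)$ the nonempty proper subsets of $X_i$. For a set $Y$, $\mathbb{Z}Y$ is the free $\mathbb{Z}$-module with basis $Y$ (so $\mathbb{Z}\mathrm{pud}X\subseteq\mathbb{Z}\mathrm{Pud}X$ and $\mathbb{Z}\mathcal{B}\subseteq\mathbb{Z}\mathrm{Pud}X$). Boxes $A,B$ form a twin pair if for some $i$, $A_j=B_j$ for $j\neq i$ and $A_i=X_i\setminus B_i$. $N(X)$ is the submodule of $\mathbb{Z}\mathrm{Pud}X$ spanned by all elements $(A\cup B)-A-B$ with $A,B\in\mathrm{Pud}X$ a twin pair. For $C\in\mathrm{pud}(X_i)$, $\varphi_C(A_i)=[A_i=C]-[A_i=X_i\setminus C]$ on $\mathrm{pud}(X_i)$ (Iverson brackets), and $\chi_{\mathcal{F}_i}$ is the characteristic function of $\mathcal{F}_i$ on $\mathrm{pud}(X_i)$. A function $f$ on proper boxes is additive if $f(A)+f(B)=f(C)+f(D)$ whenever $A,B$ and $C,D$ are twin pairs of proper boxes with $A\cup B=C\cup D$; each $\tau_D$ is additive. An additive $f$ extends to all boxes by $f(C)=\sum_{A\in\mathcal{G}}f(A)$, where $\mathcal{G}$ is any family of pairwise dichotomous proper boxes (boxes $A,B$ dichotomous if $A_i=X_i\setminus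 B_i$ for some $i$) with union $C$ (independent of the choice); $f^\dagger:\mathbb{Z}\mathrm{Pud}X\to\mathbb{R}$ denotes the $\mathbb{Z}$-linear extension of this function on $\mathrm{Pud}X$.
   Formalization: The ''Moreover'' part (the map P) is stated under the extra assumption that every X_i has at least two elements; if some X_i is a singleton there are no proper boxes, so τ_D^† is undefined and P(ℤpud X)=0≠ℤℬ. The direct sum is stated for all finite nonempty X_i. *)

(* Defs.v *)
From HB Require Import structures.
From mathcomp Require Import all_boot all_order all_algebra.

Set Implicit Arguments.
Unset Strict Implicit.
Unset Printing Implicit Defensive.

Import GRing.Theory.
Local Open Scope ring_scope.

Section Boxes.

Variables (d : nat) (X : 'I_d -> finType).

(* A nonempty product A_1 x ... x A_d determines its (nonempty) factors, so a
   box is represented by the family of its factors; [pts] is the product. *)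
Record box := Box {
  factor :> {dffun forall i : 'I_d, {set X i}};
  _ : [forall i, factor i != set0] }.

HB.instance Definition _ := [isSub for factor].
HB.instance Definition _ := [Finite of box by <:].

Definition pts (A : box) : {set {dffun forall i : 'I_d, X i}} :=
  [set x : {dffun forall i : 'I_d, X i} | [forall i, x i \in A i]].

Definition proper_box (A : box) : bool := [forall i, A i != [set: X i]].

Definition dichotomous (A B : box) : bool := [exists i, A i == ~: B i].

Definition twin (A B : box) : bool :=
  [exists i, (A i == ~: B i) && [forall j, (j != i) ==> (A j == B j)]].

(* The free Z-module with basis the finite set of all boxes. *)
Definition ZPud := {ffun box -> int}.

Definition basis_elt (A : box) : ZPud := [ffun B => (B == A)%:R].

Definition Zspan (s : seq ZPud) (x : ZPud) : Prop := inIntSpan (in_tuple s) x.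

Definition Zfree (Y : {set box}) : ZPud -> Prop :=
  Zspan [seq basis_elt A | A <- enum Y].

Definition Zpud : ZPud -> Prop := Zfree [set A | proper_box A].

(* Triples ((A, B), U) of boxes with A, B a twin pair and U = A \cup B. *)
Definition twin_unions : {set box * box * box} :=
  [set t | twin t.1.1 t.1.2 & pts t.2 == pts t.1.1 :|: pts t.1.2].

Definition NX : ZPud -> Prop :=
  Zspan [seq basis_elt t.2 - basis_elt t.1.1 - basis_elt t.1.2
        | t <- enum twin_unions].

Definition dichotomous_partition (C : box) (G : {set box}) : bool :=
  [&& [forall A in G, proper_box A],
      [forall A in G, forall B in G, (A != B) ==> dichotomous A B]
    & \bigcup_(A in G) pts A == pts C].

(* The extension to all boxes of a function f on proper boxes; the values of f
   on other boxes are never used.  For additive f the sum does not depend on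
   the family G that is picked, and such a G exists for every C as soon as each
   X_i has at least two elements. *)
Definition box_ext (V : zmodType) (f : box -> V) (C : box) : V :=
  if [pick G | dichotomous_partition C G] is Some G then \sum_(A in G) f A
  else 0.

Definition dagger (V : zmodType) (f : box -> V) (x : ZPud) : V :=
  \sum_(A : box) box_ext f A *~ x A.

Definition is_direct_sum (M N : ZPud -> Prop) : Prop :=
  (forall x, exists y z, [/\ M y, N z & x = y + z]) /\
  (forall x, M x -> N x -> x = 0).

Definition is_projection_onto (P : ZPud -> ZPud) (M : ZPud -> Prop) : Prop :=
  [/\ forall (n : int) x y, P (x *~ n + y) = P x *~ n + P y,
      forall x, P (P x) = P x
    & forall y, M y <-> exists x, P x = y].

End Boxes.

Section OneFactor.

Variable T : finType.
Implicit Types (F : {set {set T}}) (A C : {set T}).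

Definition pud1 : {set {set T}} := [set C | (C != set0) && (C != setT)].

Definition exactly_one_of_each_pair F : Prop :=
  F \subset pud1 /\ forall C, C \in pud1 -> (C \in F) (+) (~: C \in F).

Definition phi C A : int := (A == C)%:R - (A == ~: C)%:R.

Definition chi F A : int := (A \in F)%:R.

(* Only used for C in F or C = setT; the latter is never in F since F is
   included in [pud1]. *)
Definition tau1 F C A : int := if C \in F then phi C A else 1 - chi F A.

End OneFactor.

Section Projection.

Variables (d : nat) (X : 'I_d -> finType) (F : forall i, {set {set X i}}).

Definition BX : {set box X} :=
  [set D : box X | [forall i, D i \in [set: X i] |: F i]].

Definition tau (D A : box X) : int := \prod_(i < d) tau1 (F i) (D i) (A i).

Definition projP (x : ZPud X) : ZPud X :=
  \sum_(D in BX) basis_elt D *~ dagger (tau D) x.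

End Projection.

(* Main.v *)
Require Import Defs.
From mathcomp Require Import all_boot all_order all_algebra.

(** The product formula for [tau D] makes sense on every box, and on a pairwise
    dichotomous family with union a box C its values add up to [tau D C].
    To see this, write each [tau1] as an integer combination of indicators
    [S \notin F'] with F' containing exactly one set of each complementary pair
    (for D in F, [phi D] is the difference of two such indicators, obtained by
    exchanging D and its complement in F).  For products of indicators the sum
    is 0 or 1 by dichotomy, and it equals the value at C by
    [exists_transversal].

    Hence [tau D] extends linearly to a functional vanishing on N(X), and on the
    boxes of B these functionals form the dual basis, so N(X) meets ZB only in 0.
    N(X) and ZB span everything because a factor S outside F can be traded,
    modulo N(X), for X_i minus the complement of S. *)

Set Implicit Arguments.
Unset Strict Implicit.
Unset Printing Implicit Defensive.

Import GRing.Theory.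

(** * Families that choose one set from each complementary pair *)

Section OneFactor.

Variable T : finType.
Implicit Types (F : {set {set T}}) (C D S : {set T}) (x : T).

Lemma in_pud1 C : (C \in pud1 T) = (C != set0) && (C != setT).
Proof. by rewrite inE. Qed.

Lemma setC_eq C D : (~: C == D) = (C == ~: D).
Proof. by rewrite -(inj_eq (@setC_inj T)) setCK. Qed.

Lemma pud1C C : (~: C \in pud1 T) = (C \in pud1 T).
Proof. by rewrite !in_pud1 !setC_eq setCT setC0 andbC. Qed.

Lemma setC_neq S : S != set0 -> S != ~: S.
Proof.
case/set0Pn=> x xS; apply/eqP => E.
by have := xS; rewrite {1}E inE xS.
Qed.

Lemma setT_notin F : exactly_one_of_each_pair F -> setT \notin F.
Proof.
case=> /subsetP sF _; apply/negP => /sF.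
by rewrite in_pud1 eqxx andbF.
Qed.

Lemma setC_in F C : exactly_one_of_each_pair F -> C \in pud1 T ->
  (~: C \in F) = (C \notin F).
Proof. by case=> _ hF /hF; case: (C \in F); case: (~: C \in F). Qed.

(** For nonempty sets, non-membership here means containing [x]; a point of X thus becomes a choice
    of one such family in every coordinate. *)
Definition away x : {set {set T}} := [set S in pud1 T | x \notin S].

Lemma notin_away x S : S != set0 -> (S \notin away x) = (x \in S).
Proof.
move=> S0; rewrite 2!inE S0 /=; case: eqP => [->|_] /=; first by rewrite inE.
by rewrite negbK.
Qed.

Lemma away_exactly_one x : exactly_one_of_each_pair (away x).
Proof.
split=> [|C hC]; first by apply/subsetP => S; rewrite inE => /andP[].
by rewrite !inE -!in_pud1 pud1C hC /= negbK; case: (x \in C).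
Qed.

Definition flip F D : {set {set T}} := ~: D |: (F :\ D).

Lemma flip_exactly_one F D : exactly_one_of_each_pair F -> D \in F ->
  exactly_one_of_each_pair (flip F D).
Proof.
move=> hF DF; have [/subsetP sF _] := hF; split=> [|C hC].
  apply/subsetP => S; rewrite !inE => /orP[/eqP->|/andP[_ /sF]].
    by rewrite -in_pud1 pud1C sF.
  by rewrite inE.
rewrite !in_setU1 !in_setD1 (setC_in hF hC) (inj_eq (@setC_inj _)).
rewrite setC_eq.
have D0 : D != set0 by move: (sF _ DF); rewrite in_pud1 => /andP[].
have [->|CD] := eqVneq C D; first by rewrite DF (negPf (setC_neq D0)).
have [->|_] //= := eqVneq C (~: D).
by case: (C \in F).
Qed.

(** The families [flip F D] and [F] differ only at [D] and its complement, so the indicators cancel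
    at every other set. *)
Lemma tau1_chi F D S : exactly_one_of_each_pair F -> D \in F ->
  tau1 F D S = ((1 - chi (flip F D) S) - (1 - chi F S))%R.
Proof.
move=> hF DF; rewrite /tau1 DF /phi /chi !in_setU1 in_setD1.
have [/subsetP sF _] := hF.
have D0 : D != set0 by move: (sF _ DF); rewrite in_pud1 => /andP[].
have [->|SD] := eqVneq S D; first by rewrite DF (negPf (setC_neq D0)).
have [->|_] /= := eqVneq S (~: D).
  by rewrite (setC_in hF (sF _ DF)) DF.
by rewrite !subrr.
Qed.

(** The negative term of [phi] vanishes on [F] and at [setT], since [F] never contains the
    complement of a member and [D] is nonempty; [1 - chi F] vanishes on [F] and is 1 at [setT]. *)
Lemma tau1_basis F D E : exactly_one_of_each_pair F ->
  D \in setT |: F -> E \in setT |: F -> tau1 F D E = (D == E)%:R%R.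
Proof.
move=> hF; have [/subsetP sF _] := hF; have TF := setT_notin hF.
have key D' : D' \in F -> [/\ D' != setT, D' != set0 & ~: D' \notin F].
  move=> DF; have := sF _ DF; rewrite in_pud1 => /andP[-> ->]; split=> //.
  by rewrite (setC_in hF (sF _ DF)) DF.
rewrite !in_setU1 /tau1 /phi /chi => /orP[/eqP->|DF] /orP[/eqP->|EF].
- by rewrite (negPf TF) eqxx.
- by have [ET _ _] := key _ EF; rewrite (negPf TF) EF eq_sym (negPf ET).
- have [DT D0 _] := key _ DF; rewrite DF eq_sym (negPf DT).
  by rewrite eq_sym setC_eq setCT (negPf D0).
- have [_ _ DC] := key _ DF; rewrite DF eq_sym.
  by case: (E =P ~: D) EF => [-> /(negP DC)//|_ _]; rewrite subr0.
Qed.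

End OneFactor.

(** * Boxes and their dichotomous families *)

Section Boxes.

Variables (d : nat) (X : 'I_d -> finType).
Implicit Types (A B C D E : box X) (G : {set box X}).

Lemma factor_neq0 A i : A i != set0.
Proof. by case: A => f /= /forallP. Qed.

Lemma boxP A B : (forall i, A i = B i) -> A = B.
Proof. by move=> e; apply/val_inj/ffunP. Qed.

Lemma box_of_factors (f : forall i, {set X i}) :
  (forall i, f i != set0) -> {A : box X | forall i, A i = f i}.
Proof.
move=> f0; have h : [forall i, [ffun i => f i] i != set0 :> {set X i}].
  by apply/forallP => i; rewrite ffunE.
by exists (Box h) => i; rewrite /= ffunE.
Qed.

Lemma in_pts A (x : {dffun forall i, X i}) :
  (x \in pts A) = [forall i, x i \in A i].
Proof. by rewrite inE. Qed.

(* Among the pairs {S, ~S}, the families [away x] single out the sets that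
   contain x; for them the claim is that G covers C.  The induction then
   replaces them, one coordinate at a time, by arbitrary families. *)
Lemma exists_transversal G C (F : forall i, {set {set X i}}) :
  {in G &, forall A B, A != B -> dichotomous A B} ->
  \bigcup_(A in G) pts A = pts C ->
  (forall i, exactly_one_of_each_pair (F i)) ->
  (exists2 A, A \in G & forall i, A i \notin F i) <->
  (forall i, C i \notin F i).
Proof.
move=> dG cG hF.
(* Only the coordinates below [k] may carry arbitrary families; [k = d] imposes no condition. *)
have [k] : exists k, forall i : 'I_d, k <= i -> exists x, F i = away x.
  by exists d => i; rewrite leqNgt ltn_ord.
elim: k F hF => [|k IH] F hF pF.
  (* For [k = 0] the chosen points form one point [y] of X, and the claim says that [y] is covered
     by G iff it lies in C. *)
  have [x xP] := fin_all_exists (fun i => pF i (leq0n i)).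
  pose y : {dffun forall i, X i} := [ffun i => x i].
  have yP A : (forall i, A i \notin F i) <-> y \in pts A.
    rewrite in_pts; split=> [h|/forallP h].
      apply/forallP => i; move: (h i).
      by rewrite xP notin_away ?factor_neq0 ?ffunE.
    by move=> i; move: (h i); rewrite xP notin_away ?factor_neq0 ?ffunE.
  apply: iff_trans (iff_sym (yP C)); rewrite -cG.
  split=> [[A AG /yP yA]|/bigcupP[A AG /yP yA]].
    by apply/bigcupP; exists A.
  by exists A.
have [dk|kd] := leqP d k.
  by apply: IH => // i ki; have := leq_trans dk ki; rewrite leqNgt ltn_ord.
pose i0 := Ordinal kd.
pose out A := forall i, i0 != i -> A i \notin F i.
have outP A x :
    (forall i, A i \notin dfwith F (away x : {set {set X i0}}) i) <->
    out A /\ x \in A i0.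
  split=> [h|[h xA] i].
    split=> [i ne|]; first by have := h i; rewrite dfwith_out.
    by have := h i0; rewrite dfwith_in notin_away ?factor_neq0.
  have [<-|ne] := eqVneq i0 i; last by rewrite dfwith_out ?h.
  by rewrite dfwith_in notin_away ?factor_neq0.
(* The induction hypothesis with [away x] at [i0], for each [x]: the factors at [i0] of the members
   of G satisfying [out] have union [C i0] if [out C] holds, and otherwise there are no such
   members. *)
have fiber (x : X i0) :
    (exists A, [/\ A \in G, out A & x \in A i0]) <-> out C /\ x \in C i0.
  apply: iff_trans (outP C x); apply: iff_trans (IH _ _ _) => [|i|i ki].
  - split=> [[A [AG oA xA]]|[A AG /outP[oA xA]]]; last by exists A.
    by exists A => //; apply/outP.
  - have [<-|ne] := eqVneq i0 i.
      by rewrite dfwith_in; apply: away_exactly_one.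
    by rewrite dfwith_out.
  have [<-|ne] := eqVneq i0 i; first by exists x; rewrite dfwith_in.
  by rewrite dfwith_out //; apply: pF; rewrite ltn_neqAle ki andbT.
have all_out A : (forall i, A i \notin F i) <-> out A /\ A i0 \notin F i0.
  split=> [h|[oA h] i]; first by split=> // i _.
  by have [<-|/oA] := eqVneq i0 i.
have outC A : A \in G -> out A -> out C.
  move=> AG oA; have /set0Pn[x xA] := factor_neq0 A i0.
  by case: ((fiber x).1 (ex_intro _ A (And3 AG oA xA))).
(* A point of [C i0] outside [A i0] is covered by another member B. Both satisfy [out], so they can
   be dichotomous only at [i0]; their factors there fill X_i0 and lie in [C i0]. *)
have split_pair A : A \in G -> out A -> A i0 != C i0 ->
    C i0 = setT /\ exists B, [/\ B \in G, out B & B i0 = ~: A i0].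
  move=> AG oA nAC.
  have sC B : B \in G -> out B -> B i0 \subset C i0.
    move=> BG oB; apply/subsetP => x xB.
    by case: ((fiber x).1 (ex_intro _ B (And3 BG oB xB))).
  have : ~~ (C i0 \subset A i0).
    by move: nAC; rewrite eqEsubset sC.
  case/subsetPn=> x xC xA; have oC := outC _ AG oA.
  have [B [BG oB xB]] := (fiber x).2 (conj oC xC).
  have neAB : A != B by apply: contraNneq xA => ->.
  have /existsP[i /eqP eAB] := dG _ _ AG BG neAB.
  have ei : i0 = i.
    apply/eqP/negPn/negP => ne.
    have hB : B i \in pud1 (X i).
      rewrite -pud1C -eAB in_pud1 factor_neq0 eAB.
      by rewrite setC_eq setCT factor_neq0.
    by have := setC_in (hF i) hB; rewrite -eAB (negPf (oA _ ne)) oB.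
  case: i / ei eAB => eAB; split; last by exists B; rewrite eAB setCK.
  by apply/eqP; rewrite eqEsubset subsetT -(setUCr (B i0)) -eAB subUset !sC.
apply: iff_trans (iff_sym (all_out C)).
split=> [[A AG /all_out[oA nA]]|[oC nC]].
  split; first exact: outC oA.
  have [<-//|/(split_pair _ AG oA)[-> _]] := eqVneq (A i0) (C i0).
  exact: setT_notin.
have /set0Pn[x xC] := factor_neq0 C i0.
have [A [AG oA xA]] := (fiber x).2 (conj oC xC).
(* If [A i0] is in the family, it differs from [C i0], and the complementary partner B serves
   instead. *)
have [AF|nA] := boolP (A i0 \in F i0); last by exists A => //; apply/all_out.
have nAC : A i0 != C i0 by apply: contraNneq nC => <-.
have [_ [B [BG oB eB]]] := split_pair _ AG oA nAC.
exists B => //; apply/all_out; split=> //.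
have [/subsetP sF _] := hF i0.
by rewrite eB (setC_in (hF i0) (sF _ AF)) AF.
Qed.

(** At the coordinate of dichotomy the factors are nonempty and complementary, hence proper, so one
    of them lies in [F i]. *)
Lemma dichotomous_both_notin A B (F : forall i, {set {set X i}}) :
  (forall i, exactly_one_of_each_pair (F i)) -> dichotomous A B ->
  (forall i, A i \notin F i) -> (forall i, B i \notin F i) -> False.
Proof.
move=> hF /existsP[i /eqP e] nA nB.
have hB : B i \in pud1 (X i).
  rewrite -pud1C -e in_pud1 factor_neq0 e.
  by rewrite setC_eq setCT factor_neq0.
by have := setC_in (hF i) hB; rewrite -e nB (negPf (nA i)).
Qed.

Local Open Scope ring_scope.

(** * Sums of products of indicators *)

Lemma prod_natb (I : finType) (b : I -> bool) :
  \prod_i (b i)%:R = [forall i, b i]%:R :> int.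
Proof.
case: (boolP [forall i, b i]) => [/forallP h|].
  by apply: big1 => i _; rewrite h.
rewrite negb_forall => /existsP[i nb].
by rewrite (bigD1 i) //= (negPf nb) mul0r.
Qed.

Lemma sum_prod_chi G C (F : forall i, {set {set X i}}) :
  {in G &, forall A B, A != B -> dichotomous A B} ->
  \bigcup_(A in G) pts A = pts C ->
  (forall i, exactly_one_of_each_pair (F i)) ->
  \sum_(A in G) \prod_i (1 - chi (F i) (A i)) =
  \prod_i (1 - chi (F i) (C i)).
Proof.
move=> dG cG hF; have ex := exists_transversal dG cG hF.
have chiE A : \prod_i (1 - chi (F i) (A i)) = [forall i, A i \notin F i]%:R.
  by rewrite -prod_natb; apply: eq_bigr => i _; rewrite /chi; case: (_ \in _).
rewrite chiE (eq_bigr _ (fun A _ => chiE A)).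
case: (boolP [forall i, C i \notin F i]) =>
  [/forallP/ex[A AG /forallP nA]|/negP nC].
  rewrite (bigD1 A) //= nA big1 ?addr0 // => B /andP[BG neB].
  case: (boolP [forall i, _]) => // /forallP nB; exfalso.
  exact: (dichotomous_both_notin hF (dG _ _ BG AG neB) nB (elimT forallP nA)).
rewrite big1 // => A AG; case: (boolP [forall i, _]) => // /forallP nA.
by case: nC; apply/forallP/ex; exists A.
Qed.

(** * Integer spans in the free module on boxes *)

Lemma Zspan0 (s : seq (ZPud X)) : Zspan s 0.
Proof. by exists 0; rewrite big1 // => i _; rewrite ffunE mulr0z. Qed.

Lemma ZspanD (s : seq (ZPud X)) x y :
  Zspan s x -> Zspan s y -> Zspan s (x + y).
Proof.
case=> a -> [b ->]; exists (a + b); rewrite -big_split.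
by apply: eq_bigr => i _; rewrite ffunE mulrzDr.
Qed.

Lemma ZspanMz (s : seq (ZPud X)) x n : Zspan s x -> Zspan s (x *~ n).
Proof.
case=> a ->; exists (a *~ n); rewrite mulrz_suml.
by apply: eq_bigr => i _; rewrite ffunMzE mulrzz mulrzA.
Qed.

Lemma mem_Zspan (s : seq (ZPud X)) x : x \in s -> Zspan s x.
Proof.
move=> xs; have lt : (index x s < size s)%N by rewrite index_mem.
exists [ffun i => (i == Ordinal lt)%:R].
rewrite (bigD1 (Ordinal lt)) //= ffunE eqxx nth_index // big1 ?addr0 // => i ne.
by rewrite ffunE (negPf ne).
Qed.

(** Serves as an induction principle, with [M] the kernel of a functional or the image of a
    submodule. *)
Lemma Zspan_sub (s : seq (ZPud X)) (M : ZPud X -> Prop) :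
  M 0 -> (forall x y, M x -> M y -> M (x + y)) ->
  (forall x n, M x -> M (x *~ n)) -> {in s, forall x, M x} ->
  forall x, Zspan s x -> M x.
Proof.
move=> M0 MD MZ Ms x [a ->]; elim/big_ind: _ => // i _.
by apply/MZ/Ms/mem_nth.
Qed.

Lemma ZPud_sum (x : ZPud X) : x = \sum_A basis_elt A *~ x A.
Proof.
apply/ffunP => B; rewrite sum_ffunE (bigD1 B) //= ffunMzE ffunE eqxx intz.
rewrite big1 ?addr0 // => A neA.
by rewrite ffunMzE ffunE eq_sym (negPf neA) mul0rz.
Qed.

Lemma ZfreeP (Y : {set box X}) x :
  Zfree Y x <-> (forall A, A \notin Y -> x A = 0).
Proof.
split=> [xY A nA|xY].
  apply: (@Zspan_sub _ (fun x : ZPud X => x A = 0)) xY => [|y z|y n|y].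
  - by rewrite ffunE.
  - by rewrite ffunE => -> ->.
  - by rewrite ffunMzE => ->; rewrite mul0rz.
  case/mapP=> B; rewrite mem_enum => BY ->; rewrite ffunE.
  by case: eqP BY nA => // -> ->.
rewrite [x]ZPud_sum; apply: big_ind => [|y z|A _]; first exact: Zspan0.
  exact: ZspanD.
have [AY|/xY->] := boolP (A \in Y); last by rewrite mulr0z; apply: Zspan0.
by apply/ZspanMz/mem_Zspan; rewrite map_f ?mem_enum.
Qed.

(** * The functionals given by [tau] and the direct sum *)

Section Tau.

Variable F : forall i, {set {set X i}}.
Hypothesis hF : forall i, exactly_one_of_each_pair (F i).

Lemma sum_tau G C D :
  {in G &, forall A B, A != B -> dichotomous A B} ->
  \bigcup_(A in G) pts A = pts C ->
  \sum_(A in G) tau F D A = tau F D C.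
Proof.
move=> dG cG.
(* If [D i] is in [F i], [true] selects the flipped family with sign +1 and [false] selects [F i]
   with sign -1. Otherwise only [false] counts: [true] has coefficient 0. *)
pose K i b := if ~~ b || (D i \notin F i) then F i else flip (F i) (D i).
pose c i b : int := if D i \in F i then (-1) ^+ ~~ b else (~~ b)%:R.
have tauE A : tau F D A =
    \sum_(e : {ffun 'I_d -> bool})
      (\prod_i c i (e i)) * \prod_i (1 - chi (K i (e i)) (A i)).
  rewrite /tau; under eq_bigr => i _.
    have -> : tau1 (F i) (D i) (A i) =
        \sum_(b : bool) c i b * (1 - chi (K i b) (A i)).
      rewrite big_bool /= /c /K; case: ifP => DF.
        by rewrite (tau1_chi _ (hF i) DF) /= expr0 expr1 mul1r mulN1r.
      by rewrite /tau1 DF mul0r mul1r add0r.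
    over.
  by rewrite bigA_distr_bigA /=; apply: eq_bigr => e _; rewrite big_split.
rewrite tauE (eq_bigr _ (fun A _ => tauE A)) exchange_big /=.
apply: eq_bigr => e _; rewrite -mulr_sumr; congr (_ * _).
apply: sum_prod_chi => // i; rewrite /K.
case: (boolP (D i \in F i)) => DF; last by rewrite orbT.
by case: (e i) => //=; apply: flip_exactly_one.
Qed.

Lemma in_BX D : (D \in BX F) = [forall i, D i \in setT |: F i].
Proof. by rewrite inE. Qed.

Lemma tau_basis D E : D \in BX F -> E \in BX F -> tau F D E = (D == E)%:R.
Proof.
rewrite !in_BX => /forallP hD /forallP hE; rewrite /tau.
under eq_bigr => i _ do rewrite (tau1_basis (hF i) (hD i) (hE i)).
rewrite prod_natb; congr (_%:R); congr nat_of_bool.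
apply/forallP/eqP => [h|-> //].
by apply: boxP => i; apply/eqP.
Qed.

(** Extends the product formula on all boxes directly, so that the direct sum is obtained without
    partitions into proper boxes; [box_ext_tau] links it to [dagger]. *)
Definition tau_lin D (x : ZPud X) : int := \sum_A tau F D A *~ x A.

Lemma tau_linD D : {morph tau_lin D : x y / x + y}.
Proof.
move=> x y; rewrite /tau_lin -big_split; apply: eq_bigr => A _.
by rewrite ffunE mulrzDr.
Qed.

Lemma tau_linMz D n : {morph tau_lin D : x / x *~ n}.
Proof.
move=> x; rewrite /tau_lin mulrz_suml; apply: eq_bigr => A _.
by rewrite ffunMzE !mulrzz mulrA.
Qed.

Lemma tau_lin0 D : tau_lin D 0 = 0.
Proof. by apply: big1 => A _; rewrite ffunE mulr0z. Qed.

Lemma tau_linB D : {morph tau_lin D : x y / x - y}.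
Proof. by move=> x y; rewrite tau_linD -mulrN1z tau_linMz mulrN1z. Qed.

Lemma tau_lin_sum D (I : finType) (P : pred I) (f : I -> ZPud X) :
  tau_lin D (\sum_(i | P i) f i) = \sum_(i | P i) tau_lin D (f i).
Proof. exact: (big_morph _ (tau_linD D) (tau_lin0 D)). Qed.

Lemma tau_lin_basis D A : tau_lin D (basis_elt A) = tau F D A.
Proof.
rewrite /tau_lin (bigD1 A) //= ffunE eqxx big1 ?addr0 // => B neB.
by rewrite ffunE (negPf neB).
Qed.

(** A twin pair is itself a dichotomous family with union U, so [sum_tau] kills each generator. *)
Lemma tau_lin_NX D x : NX x -> tau_lin D x = 0.
Proof.
apply: (@Zspan_sub _ (fun x => tau_lin D x = 0)) => [|y z|y n|y].
- exact: tau_lin0.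
- by rewrite tau_linD => -> ->.
- by rewrite tau_linMz => ->; rewrite mul0rz.
case/mapP=> [[[A B] U]]; rewrite mem_enum inE /= => /andP[tw /eqP eU] ->.
have [i /andP[eAB _]] := existsP tw.
have neAB : A != B.
  by apply: contraTneq eAB => ->; rewrite setC_neq ?factor_neq0.
have dAB : dichotomous A B by apply/existsP; exists i.
rewrite !tau_linB !tau_lin_basis -(@sum_tau [set A; B] U D).
- by rewrite big_setU1 ?inE //= big_set1 -addrA -opprD subrr.
- move=> A' B'; rewrite !inE => /orP[]/eqP-> /orP[]/eqP->; rewrite ?eqxx //.
  by move=> _; apply/existsP; exists i; rewrite (eqP eAB) setCK.
by rewrite bigcup_setU !big_set1.
Qed.

Lemma tau_lin_id D x : D \in BX F -> Zfree (BX F) x -> tau_lin D x = x D.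
Proof.
move=> DB /ZfreeP xB; rewrite /tau_lin (bigD1 D) //= tau_basis // eqxx.
rewrite big1 ?addr0 ?intz // => A neA.
have [AB|/xB->] := boolP (A \in BX F); last by rewrite mulr0z.
by rewrite tau_basis // eq_sym (negPf neA) mul0rz.
Qed.

(** Induction on the number of factors that are neither X_i nor in [F i]. At such a coordinate, A is
    congruent modulo [NX] to U - B, where U and B have X_i and the complement of [A i] there. *)
Lemma basis_decomposition A :
  exists y z, [/\ NX y, Zfree (BX F) z & basis_elt A = y + z].
Proof.
have [n] := ubnP #|[set i | A i \notin setT |: F i]|.
elim: n A => // n IH A; rewrite ltnS => leA.
have [AB|] := boolP (A \in BX F).
  exists 0, (basis_elt A); split; first exact: Zspan0; last by rewrite add0r.
  by apply: mem_Zspan; rewrite map_f ?mem_enum.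
rewrite in_BX negb_forall => /existsP[i nAi].
have [AT AF] : A i != setT /\ A i \notin F i.
  by move: nAi; rewrite in_setU1 negb_or => /andP.
have hA : A i \in pud1 (X i) by rewrite in_pud1 factor_neq0.
(* An admissible set at [i] lowers the count, so the induction hypothesis covers the modified
   box. *)
have upd (S : {set X i}) : S != set0 -> S \in setT |: F i ->
    exists B, [/\ B i = S, forall j, i != j -> B j = A j
      & exists y z, [/\ NX y, Zfree (BX F) z & basis_elt B = y + z]].
  move=> S0 SB; have [|B BE] := @box_of_factors (dfwith A S).
    move=> j; have [<-|ne] := eqVneq i j; first by rewrite dfwith_in.
    by rewrite dfwith_out ?factor_neq0.
  have Bi : B i = S by rewrite BE dfwith_in.
  have Bj j : i != j -> B j = A j by move=> ne; rewrite BE dfwith_out.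
  exists B; split=> //; apply: IH; apply: leq_trans leA; apply: proper_card.
  apply/properP; split; last by exists i; rewrite inE // Bi SB.
  apply/subsetP => j; rewrite !(inE, in_setU1).
  by have [<-|/Bj->] := eqVneq i j; rewrite // Bi -in_setU1 SB.
have CF : ~: A i \in setT |: F i.
  by rewrite in_setU1 (setC_in (hF i)) // AF orbT.
have T0 : [set: X i] != set0.
  by apply: contraNneq (factor_neq0 A i) => T0; rewrite -subset0 -T0 subsetT.
have [U [Ui Uj [yU [zU [NU BU eU]]]]] := upd _ T0 (setU11 _ _).
have C0 : ~: A i != set0 by rewrite setC_eq setC0.
have [B [Bi Bj [yB [zB [NB BB eB]]]]] := upd _ C0 CF.
(* The generator for the twin pair A, B with union U; solving it for A yields the two components
   supplied below. *)
pose g := basis_elt U - basis_elt A - basis_elt B.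
have Ng : NX g.
  apply/mem_Zspan/mapP; exists ((A, B), U) => //; rewrite mem_enum inE /=.
  apply/andP; split.
    apply/existsP; exists i; rewrite Bi setCK eqxx /=.
    by apply/forallP => j; apply/implyP; rewrite eq_sym => /Bj->.
  apply/eqP/setP => x; rewrite in_setU !in_pts.
  apply/forallP/orP => [xU|xAB j].
    case: (boolP (x i \in A i)) => xi; [left|right]; apply/forallP => j.
      by have [<-//|ne] := eqVneq i j; rewrite -Uj.
    by have [<-|ne] := eqVneq i j; rewrite ?Bi ?inE // Bj // -Uj.
  have [<-|ne] := eqVneq i j; first by rewrite Ui inE.
  by case: xAB => /forallP/(_ j); rewrite ?Bj // Uj.
exists (yU + yB *~ (-1) + g *~ (-1)), (zU + zB *~ (-1)); split.
- by apply: ZspanD; [apply: ZspanD => //|]; apply: ZspanMz.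
- by apply: ZspanD => //; apply: ZspanMz.
have -> : basis_elt A = basis_elt U - basis_elt B - g.
  by rewrite /g opprD opprB opprK addrACA addNr addr0 addrC subrK.
by rewrite !mulrN1z eU eB opprD addrACA; apply: addrAC.
Qed.

Lemma decomposition (x : ZPud X) :
  exists y z, [/\ NX y, Zfree (BX F) z & x = y + z].
Proof.
rewrite [x]ZPud_sum.
pose M (x : ZPud X) := exists y z, [/\ NX y, Zfree (BX F) z & x = y + z].
apply: (big_ind M) => [|_ _ [y [z [Ny Bz ->]]] [y' [z' [Ny' Bz' ->]]]|A _].
- by exists 0, 0; split; [exact: Zspan0 | exact: Zspan0 | rewrite addr0].
- by exists (y + y'), (z + z'); split;
    [exact: ZspanD | exact: ZspanD | rewrite addrACA].
have [y [z [Ny Bz ->]]] := basis_decomposition A.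
exists (y *~ x A), (z *~ x A); split; [exact: ZspanMz | exact: ZspanMz |].
by rewrite mulrzDl.
Qed.

Lemma NX_Zfree_eq0 x : NX x -> Zfree (BX F) x -> x = 0.
Proof.
move=> Nx Bx; apply/ffunP => D; rewrite ffunE.
have [DB|nD] := boolP (D \in BX F); last by move/ZfreeP: Bx; apply.
by rewrite -(tau_lin_id DB Bx) tau_lin_NX.
Qed.

Lemma dichotomous_partitionP C G : dichotomous_partition C G ->
  [/\ {in G, forall A, proper_box A},
      {in G &, forall A B, A != B -> dichotomous A B}
    & \bigcup_(A in G) pts A = pts C].
Proof.
case/and3P=> /forall_inP pG /forall_inP dG /eqP cG; split=> // A B AG BG ne.
by have /forall_inP/(_ B BG) := dG A AG; rewrite ne.
Qed.

(** * The projection, when every factor has at least two points *)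

Section Proper.

Hypothesis hX : forall i, (1 < #|X i|)%N.

(** Split each full factor of C into a fixed pair [S i], [~: S i], keep the other factors, and take
    all resulting boxes. *)
Lemma dichotomous_partition_exists C : exists G, dichotomous_partition C G.
Proof.
have /fin_all_exists[S hS] i : exists S, S \in pud1 (X i).
  have /card_gt0P[x _] : (0 < #|X i|)%N by apply: ltnW.
  exists [set x]; rewrite in_pud1 -card_gt0 cards1 /=.
  by apply: contraTneq (hX i) => e; rewrite -cardsT -e cards1.
pose ok i (A : {set X i}) :=
  if C i == setT then (A == S i) || (A == ~: S i) else A == C i.
exists [set A : box X | [forall i, ok i (A i)]]; apply/and3P; split.
- apply/forall_inP => A; rewrite inE => /forallP okA; apply/forallP => i.
  move: (okA i); rewrite /ok; case: ifPn => [_|CT /eqP-> //].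
  have := hS i; rewrite -pud1C; have := hS i.
  by rewrite !in_pud1 => /andP[_ ST] /andP[_ ST'] /orP[]/eqP->.
- apply/forall_inP => A; rewrite inE => /forallP okA.
  apply/forall_inP => B; rewrite inE => /forallP okB.
  apply/implyP => neAB; apply/existsP.
  have /existsP[i ne] : [exists i, A i != B i].
    rewrite -negb_forall; apply: contraNN neAB => /forallP e.
    by apply/eqP/boxP => i; apply/eqP.
  exists i; move: (okA i) (okB i) ne; rewrite /ok.
  case: ifP => _ => [|/eqP-> /eqP->]; last by rewrite eqxx.
  by move=> /orP[]/eqP-> /orP[]/eqP->; rewrite ?setCK ?eqxx.
apply/eqP/setP => x; apply/bigcupP/idP => [[A]|].
  rewrite inE => /forallP okA; rewrite !in_pts => /forallP xA.
  apply/forallP => i; move: (okA i); rewrite /ok.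
  case: ifP => [/eqP-> _|_ /eqP<- //].
  by rewrite inE.
rewrite in_pts => /forallP xC.
(* In each split coordinate, take the half that contains [x i]. *)
have [|A AE] := @box_of_factors (fun i =>
  if C i == setT then if x i \in S i then S i else ~: S i else C i).
  move=> i; case: ifP => [_|_]; last exact: factor_neq0.
  have := hS i; rewrite -pud1C; have := hS i.
  by rewrite !in_pud1 => /andP[? _] /andP[? _]; case: ifP.
exists A; first rewrite inE; last rewrite in_pts; apply/forallP => i.
  rewrite /ok AE; case: (C i == setT) => //.
  by case: ifP => _; rewrite eqxx ?orbT.
rewrite AE; case: ifP => [_|_]; last exact: xC.
by case: ifPn => //; rewrite inE.
Qed.

(** By [sum_tau] every family gives the same sum, and the default 0 is never reached because a
    family exists. *)
Lemma box_ext_tau D C : box_ext (tau F D) C = tau F D C.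
Proof.
rewrite /box_ext; case: pickP => [G /dichotomous_partitionP[_ dG cG]|noG].
  exact: sum_tau.
by have [G] := dichotomous_partition_exists C; rewrite noG.
Qed.

Lemma projPE x D : projP F x D = if D \in BX F then tau_lin D x else 0.
Proof.
have daggerE E : dagger (tau F E) x = tau_lin E x.
  by apply: eq_bigr => A _; rewrite box_ext_tau.
rewrite sum_ffunE; case: ifP => DB.
  rewrite (bigD1 D) //= ffunMzE ffunE eqxx daggerE intz big1 ?addr0 // => E.
  by case/andP=> _ neE; rewrite ffunMzE ffunE eq_sym (negPf neE) mul0rz.
apply: big1 => E EB; rewrite ffunMzE ffunE.
by case: eqP EB DB => [-> ->|_ _ _]; rewrite ?mul0rz.
Qed.

Lemma projP_linear (n : int) x y :
  projP F (x *~ n + y) = projP F x *~ n + projP F y.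
Proof.
apply/ffunP => D; rewrite ffunE ffunMzE !projPE; case: ifP => _.
  by rewrite tau_linD tau_linMz.
by rewrite mul0rz addr0.
Qed.

Lemma projP_Zfree x : Zfree (BX F) (projP F x).
Proof. by apply/ZfreeP => D nD; rewrite projPE (negPf nD). Qed.

Lemma projP_id x : Zfree (BX F) x -> projP F x = x.
Proof.
move=> Bx; apply/ffunP => D; rewrite projPE; case: ifPn => [DB|nD].
  exact: tau_lin_id.
by symmetry; move/ZfreeP: Bx; apply.
Qed.

Lemma projP_NX x : NX x -> projP F x = 0.
Proof.
move=> Nx; apply/ffunP => D; rewrite projPE ffunE; case: ifP => // _.
exact: tau_lin_NX.
Qed.

(** For x = y + z as in [decomposition], P kills y and fixes z, so P x = z. *)
Lemma projP_ker x : projP F x = 0 <-> NX x.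
Proof.
split=> [Px|]; last exact: projP_NX.
have [y [z [Ny Bz e]]] := decomposition x.
have := projP_linear 1 y z; rewrite !mulr1z -e Px projP_NX // add0r projP_id //.
by move=> z0; rewrite e -z0 addr0.
Qed.

(** A basis box D is the image of the sum of any dichotomous family of proper boxes with union D,
    since each [tau F E] takes the same value on both. *)
Lemma projP_proper y : Zfree (BX F) y ->
  exists2 x, @Zpud d X x & projP F x = y.
Proof.
have P0 : projP F 0 = 0 by apply: projP_NX; apply: Zspan0.
move: y; apply: (@Zspan_sub _ (fun y =>
  exists2 x, @Zpud d X x & projP F x = y)).
- by exists 0; first exact: Zspan0.
- move=> _ _ [x px <-] [x' px' <-]; exists (x + x'); first exact: ZspanD.
  by have := projP_linear 1 x x'; rewrite !mulr1z.
- move=> _ n [x px <-]; exists (x *~ n); first exact: ZspanMz.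
  by have := projP_linear n x 0; rewrite P0 !addr0.
move=> y /mapP[D]; rewrite mem_enum => DB ->.
have [G /dichotomous_partitionP[pG dG cG]] := dichotomous_partition_exists D.
exists (\sum_(A in G) basis_elt A).
  apply: (big_ind (@Zpud d X)) => [|x x'|A AG].
  - exact: Zspan0.
  - exact: ZspanD.
  by apply/mem_Zspan/map_f; rewrite mem_enum inE pG.
apply/ffunP => E; rewrite projPE ffunE; case: ifPn => [EB|nE].
  rewrite tau_lin_sum (eq_bigr _ (fun A _ => tau_lin_basis E A)).
  by rewrite (sum_tau _ dG cG) tau_basis.
by case: eqP nE DB => // -> /negPf->.
Qed.

End Proper.

End Tau.

End Boxes.

Theorem theorem9p4 (d : nat) (X : 'I_d -> finType)
    (F : forall i : 'I_d, {set {set X i}})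
    (hX : forall i, 0 < #|X i|)
    (hF : forall i, exactly_one_of_each_pair (F i)) :
  is_direct_sum (@NX d X) (Zfree (BX F)) /\
  ((forall i, 1 < #|X i|) ->
    [/\ is_projection_onto (projP F) (Zfree (BX F)),
        forall x : ZPud X, projP F x = 0%R <-> NX x
      & forall y : ZPud X,
          Zfree (BX F) y <-> exists2 x : ZPud X, Zpud x & projP F x = y]).
Proof.
split; first by split; [exact: decomposition | exact: NX_Zfree_eq0].
move=> hX1; split.
- split=> [n x y|x|y]; first exact: projP_linear.
    by apply/(projP_id hF hX1)/projP_Zfree.
  split=> [By|[x <-]]; last exact: projP_Zfree.
  by exists y; apply: projP_id.
- by move=> x; apply: projP_ker.
move=> y; split=> [|[x _ <-]]; first exact: projP_proper.
exact: projP_Zfree.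
Qed.
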